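(* Let $s:\mathcal{X}\times\mathcal{Y}\to\mathbb{R}$ be measurable, $S_1,\dots,S_d$ probability distributions on $\mathcal{X}\times\mathcal{Y}$, $f$ a function as described in the context, and $\rho>0$. Let $F_1,\dots,F_d$ be the c.d.f.'s of $s\#S_1,\dots,s\#S_d$ and let $F_{\min}(x)\coloneqq\min_{1\le i\le d}F_i(x)$ (which is a c.d.f.). Define $g_{f,\rho}:[0,1]\to[0,1]$ by $$g_{f,\rho}(\beta)\coloneqq\inf\left\{z\in[0,1] : \beta f\left(\tfrac{z}{\beta}\right)+(1-\beta)f\left(\tfrac{1-z}{1-\beta}\right)\le\rho\right\}$$ and $g_{f,\rho}^{-1}(\tau)\coloneqq\sup\{\beta\in[0,1] : g_{f,\rho}(\beta)\le\tau\}$. Let $$\mathcal{P}_{f,\rho}\coloneqq\{S \text{ a distribution on }\mathbb{R} : \exists S_0\in\mathcal{CH}(s\#S_1,\dots,s\#S_d)\text{ with } D_f(S\Vert S_0)\le\rho\}$$ and $\widetilde{\mathcal{Q}}(\alpha;\mathcal{P}_{f,\rho})\coloneqq\sup_{P\in\mathcal{P}_{f,\rho}}\mathcal{Q}(\alpha;P)$. Then for all $\alpha\in(0,1)$, $$\widetilde{\mathcal{Q}}(\alpha;\mathcal{P}_{f,\rho})=\mathcal{Q}\left(g_{f,\rho}^{-1}(\alpha);F_{\min}\right).$$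
   Context: $f:\mathbb{R}\to\mathbb{R}\cup\{+\infty\}$ is a closed convex function with $f(1)=0$ and $f(t)=+\infty$ for $t<0$. For probability distributions $P\ll Q$, $D_f(P\Vert Q)\coloneqq\int f\left(\frac{dP}{dQ}\right)dQ$. $\mathcal{CH}(P_1,\dots,P_d)\coloneqq\{\sum_{i=1}^d\lambda_iP_i:\lambda_i\ge0,\sum_i\lambda_i=1\}$. $s\#T$ is the push-forward $(s\#T)(A)=T(s^{-1}(A))$. Quantiles: for a distribution $P$ on $\mathbb{R}$, $\mathcal{Q}(\beta;P)\coloneqq\inf\{q : P(S\le q)\ge\beta\}$; for a c.d.f. $F$, $\mathcal{Q}(\beta;F)\coloneqq\inf\{q : F(q)\ge\beta\}$. *)

(* Defs.v *)
From HB Require Import structures.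
From mathcomp Require Import all_boot all_order all_algebra.
From mathcomp Require Import all_classical all_reals all_analysis.
Set Implicit Arguments. Unset Strict Implicit. Unset Printing Implicit Defensive.
Import Order.TTheory GRing.Theory Num.Theory numFieldNormedType.Exports.
Local Open Scope classical_set_scope.
Local Open Scope ring_scope.

Section defs.
Context {R : realType}.
Local Open Scope ereal_scope.
Local Open Scope charge_scope.

Definition fdiv_generator (f : R -> \bar R) : Prop :=
  [/\ (forall t, f t != -oo),
      (forall x y (t : R), (0 <= t <= 1)%R ->
          f (t * x + (1 - t) * y)%R <= t%:E * f x + (1 - t)%:E * f y),
      closed [set p : (R * R)%type | f p.1 <= p.2%:E],
      f 1%R = 0 &
      (forall t, (t < 0)%R -> f t = +oo)].

Definition fdiv (f : R -> \bar R) (P Q : probability R R) : \bar R :=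
  if `[< P `<< Q >] then
    \int[Q]_x f (fine ('d (charge_of_finite_measure P) '/d Q x))
  else +oo.

Definition quantile (P : set R -> \bar R) (beta : R) : \bar R :=
  ereal_inf [set q%:E | q in [set q : R | beta%:E <= P `]-oo, q]%classic]].

Definition quantile_cdf (F : R -> R) (beta : R) : \bar R :=
  ereal_inf [set q%:E | q in [set q : R | (beta <= F q)%R]].

Definition persp (f : R -> \bar R) (b x : R) : \bar R :=
  if (0 < b)%R then b%:E * f (x / b)%R else if x == 0%R then 0 else +oo.

Definition g_fun (f : R -> \bar R) (rho : R) (beta : R) : R :=
  inf [set z : R | (0 <= z <= 1)%R /\
        persp f beta z + persp f (1 - beta) (1 - z) <= rho%:E].

Definition g_inv (f : R -> \bar R) (rho : R) (tau : R) : R :=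
  sup [set beta : R | (0 <= beta <= 1)%R /\ (g_fun f rho beta <= tau)%R].

End defs.

(* Main.v *)
(* For [A = ]-oo, q]], data processing shows that a distribution [P] within
   divergence [rho] of [S0] satisfies [h(S0 A, P A) <= rho], where [h] is the
   two-point divergence in the definition of [g]; conversely every [z] with
   [h(S0 A, z) <= rho] is [P A] for the [P] whose density with respect to [S0]
   is constant on [A] and on its complement. Hence the worst-case quantile
   exceeds [q] exactly when some mixture [S0] has a [z < alpha] feasible at
   [S0 A], and by monotonicity it suffices to look at [Fmin q], which is
   attained by one of the [S_i]. Since the feasible set contains (0, 0) and
   (1, 1) and is star-shaped with respect to both, such a [z] exists exactly
   when [Fmin q < g^-1 alpha]. *)
Require Import Defs.
From HB Require Import structures.
From mathcomp Require Import all_boot all_order all_algebra.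
From mathcomp Require Import all_classical all_reals all_analysis.
From mathcomp Require Import measurable_realfun ring lra.
Import Order.TTheory GRing.Theory Num.Theory numFieldNormedType.Exports.
Local Open Scope classical_set_scope.
Local Open Scope ring_scope.

(** * Projection onto closed convex subsets of the plane, and Jensen's inequality *)

(** Here [c] minimises the squared distance to [p], which exists by compactness once [C] is cut down
    to a box; if some [w] violated the inequality, a small move from [c] towards [w] would come
    closer to [p]. *)
Lemma closed_convex_projection (R : realType) (C : set (R * R)) (p : R * R) :
  closed C -> C !=set0 ->
  (forall u v t, C u -> C v -> 0 <= t <= 1 ->
    C (t * u.1 + (1 - t) * v.1, t * u.2 + (1 - t) * v.2)) ->
  exists2 c, C c & forall w, C w ->
    (p.1 - c.1) * (w.1 - c.1) + (p.2 - c.2) * (w.2 - c.2) <= 0.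
Proof.
move=> clC [w0 Cw0] cvxC.
pose dist (w : R * R) := (p.1 - w.1) ^+ 2 + (p.2 - w.2) ^+ 2.
(* From [x ^+ 2 <= D] follows [|x| <= 1 + D], so this box contains every point at least as close to
   [p] as [w0], without taking square roots. *)
pose M := 1 + dist w0.
pose box := `[p.1 - M, p.1 + M]%classic `*` `[p.2 - M, p.2 + M]%classic.
have sqle (x : R) : x ^+ 2 <= dist w0 -> - M <= x <= M.
  rewrite /M => x2; have := sqr_ge0 (x - 1); have := sqr_ge0 (x + 1).
  by move: (dist w0) x2 => D; nra.
have boxP (w : R * R) : dist w <= dist w0 -> box w.
  move=> ww0.
  have h1 : (p.1 - w.1) ^+ 2 <= dist w0.
    by apply: le_trans ww0; rewrite lerDl sqr_ge0.
  have h2 : (p.2 - w.2) ^+ 2 <= dist w0.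
    by apply: le_trans ww0; rewrite lerDr sqr_ge0.
  by split => /=; rewrite in_itv /=; [have := sqle _ h1|have := sqle _ h2]; lra.
have cpt : compact (C `&` box).
  rewrite setIC; apply: compact_closedI => //.
  by apply: compact_setX; exact: segment_compact.
have cdist : {within C `&` box, continuous dist}.
  apply: continuous_subspaceT => w.
  by apply: cvgD; apply: cvgM; apply: cvgB;
    [exact: cvg_cst|exact: cvg_fst|exact: cvg_cst|exact: cvg_fst
    |exact: cvg_cst|exact: cvg_snd|exact: cvg_cst|exact: cvg_snd].
have [|c] := compact_EVT_min _ cpt cdist.
  by exists w0; split => //; exact: boxP.
rewrite inE => -[Cc _] cmin; exists c => // w Cw.
have {}cmin u : C u -> dist c <= dist u.
  move=> Cu; have [uw0|/ltW uw0] := leP (dist u) (dist w0).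
    by apply: cmin; rewrite inE; split => //; exact: boxP.
  by apply: le_trans uw0; apply: cmin; rewrite inE; split => //; exact: boxP.
set ip := (X in X <= 0); rewrite leNgt; apply/negP => ip0.
pose N := (w.1 - c.1) ^+ 2 + (w.2 - c.2) ^+ 2.
have N0 : 0 <= N by rewrite addr_ge0 ?sqr_ge0.
(* The squared distance along the segment changes by [- 2 * t * ip + t ^+ 2 * N]. This [t] stays in
   []0, 1]] even if [N = 0], and makes the change equal to [- t * ip - t ^+ 2 * ip < 0]. *)
pose t := ip / (ip + N).
have t01 : 0 < t <= 1.
  have ipN : 0 < ip + N by rewrite ltr_wpDr.
  by apply/andP; split; [exact: divr_gt0|rewrite ler_pdivrMr// mul1r lerDl].
have := cmin _ (cvxC _ _ t Cw Cc _); rewrite {1}ltW ?(andP t01).2 ?(andP t01).1//.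
move=> /(_ isT).
have -> : dist (t * w.1 + (1 - t) * c.1, t * w.2 + (1 - t) * c.2) =
    dist c - 2 * t * ip + t ^+ 2 * N.
  by rewrite /dist /ip /N /=; ring.
have tN : t * N = ip - t * ip by rewrite /t; field; rewrite gt_eqF// ltr_wpDr.
have -> : t ^+ 2 * N = t * (t * N) by ring.
rewrite tN; case/andP: t01 => t0 _.
have : 0 < t * ip by exact: mulr_gt0.
have : 0 < t * (t * ip) by apply: mulr_gt0 => //; exact: mulr_gt0.
by lra.
Qed.

(* The mean [p] is equal to its projection [c] on [C]: integrating the variational
   inequality satisfied by [c] gives [|p - c|^2 <= 0]. This needs no case analysis
   on vertical supporting lines when [C] is an epigraph. *)
Lemma jensen_closed_convex d (T : measurableType d) (R : realType)
    (mu : {finite_measure set T -> \bar R}) (A : set T) (C : set (R * R))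
    (r v : T -> R) :
  measurable A -> (0 < mu A)%E ->
  mu.-integrable A (EFin \o r) -> mu.-integrable A (EFin \o v) ->
  closed C ->
  (forall u w t, C u -> C w -> 0 <= t <= 1 ->
    C (t * u.1 + (1 - t) * w.1, t * u.2 + (1 - t) * w.2)) ->
  (forall x, A x -> C (r x, v x)) ->
  C (\int[mu]_(x in A) r x / fine (mu A), \int[mu]_(x in A) v x / fine (mu A)).
Proof.
move=> mA A0 ir iv clC cvxC AC.
have mfin : mu A \is a fin_num by exact: fin_num_measure.
have m0 : 0 < fine (mu A) by rewrite -lte_fin fineK.
have C0 : C !=set0.
  have /set0P[x Ax] : A != set0.
    by apply/eqP => A0'; move: A0; rewrite A0' measure0 ltxx.
  by exists (r x, v x); exact: AC.
set m := fine _ in m0 *; set p := (_ / _, _ / _).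
have [c Cc cP] := closed_convex_projection _ _ p clC C0 cvxC.
have iZ (a : R) (g : T -> R) : mu.-integrable A (EFin \o g) ->
    mu.-integrable A (EFin \o (fun x => a * g x)).
  by move=> ig; have := integrableZl mA a ig; apply: eq_integrable.
have iD : mu.-integrable A
    (EFin \o (fun x => (p.1 - c.1) * r x + (p.2 - c.2) * v x)).
  have := integrableD mA (iZ (p.1 - c.1) _ ir) (iZ (p.2 - c.2) _ iv).
  exact: eq_integrable.
have : \int[mu]_(x in A) ((p.1 - c.1) * r x + (p.2 - c.2) * v x) <=
    \int[mu]_(x in A) ((p.1 - c.1) * c.1 + (p.2 - c.2) * c.2).
  apply: le_Rintegral => //.
    apply: (@eq_integrable _ _ _ _ A mA (cst ((p.1 - c.1) * c.1 + (p.2 - c.2) * c.2)%:E)) => //.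
    by apply: finite_measure_integrable_cst.
  by move=> x /AC /cP /=; lra.
rewrite RintegralD//; [|exact: iZ..].
rewrite !RintegralZl// Rintegral_cst//.
have -> : \int[mu]_(x in A) r x = p.1 * m by rewrite divfK ?gt_eqF.
have -> : \int[mu]_(x in A) v x = p.2 * m by rewrite divfK ?gt_eqF.
rewrite -/m => h.
have {}h : (p.1 - c.1) ^+ 2 + (p.2 - c.2) ^+ 2 <= 0.
  by rewrite -(pmulr_lle0 _ m0); nra.
have := sqr_ge0 (p.1 - c.1); have := sqr_ge0 (p.2 - c.2) => h2 h1.
suff -> : p = c by [].
rewrite [p]surjective_pairing [c]surjective_pairing; congr (_, _).
  by apply/eqP; rewrite -subr_eq0 -sqrf_eq0; apply/eqP; lra.
by apply/eqP; rewrite -subr_eq0 -sqrf_eq0; apply/eqP; lra.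
Qed.

(** * The perspective of [f] and the star-shaped feasible region *)

Section perspective.
Context (R : realType) (f : R -> \bar R) (hf : fdiv_generator f).
Local Open Scope ereal_scope.

Let fN x : f x != -oo. Proof. by case: hf. Qed.
Let f1 : f 1%R = 0. Proof. by case: hf. Qed.

Lemma persp_neqNy b x : persp f b x != -oo.
Proof.
rewrite /persp; case: ifPn => [b0|_]; last by case: ifP.
have := fN (x / b)%R; case: (f _) => [r||]//= _.
by rewrite gt0_muley ?lte_fin.
Qed.

Lemma perspxx b : (0 <= b)%R -> persp f b b = 0.
Proof.
rewrite /persp le_eqVlt => /predU1P[<-|b0]; first by rewrite ltxx eqxx.
by rewrite b0 divff ?gt_eqF// f1 mule0.
Qed.

Lemma perspZ t b x : (0 < t)%R ->
  persp f (t * b) (t * x) = t%:E * persp f b x.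
Proof.
move=> t0; rewrite /persp pmulr_rgt0//; case: ifPn => b0.
  rewrite EFinM muleA; congr (_ * f _).
  by rewrite invfM mulrACA divff ?gt_eqF// mul1r.
rewrite mulf_eq0 gt_eqF//=; case: ifP => _; first by rewrite mule0.
by rewrite gt0_muley ?lte_fin.
Qed.

(** Joint convexity of the perspective on the segment from [(1, 1)], where it vanishes since
    [f 1 = 0]. For [b > 0] this is convexity of [f] between [1] and [x / b], with weights [1 - t]
    and [t * b] divided by their sum. *)
Lemma persp_convex1 t b x : (0 <= t <= 1)%R -> (0 <= b)%R ->
  persp f (1 - t + t * b) (1 - t + t * x) <= t%:E * persp f b x.
Proof.
move=> /andP[]; rewrite le_eqVlt => /predU1P[<- _ _|t0 t1].
  by rewrite !mul0r !subr0 !addr0 perspxx ?ler01// mul0e.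
rewrite le_eqVlt => /predU1P[<-|b0].
  rewrite mulr0 addr0 {2}/persp ltxx; case: eqP => [->|_].
    by rewrite mulr0 addr0 perspxx ?subr_ge0// mule0.
  by rewrite gt0_muley ?lte_fin// leey.
have w0 : (0 < 1 - t + t * b)%R.
  by rewrite ltr_wpDl ?subr_ge0// mulr_gt0.
rewrite /persp w0 b0.
case: hf => _ cvx _ _ _.
have := cvx 1%R (x / b)%R ((1 - t) / (1 - t + t * b))%R.
have -> : (0 <= (1 - t) / (1 - t + t * b) <= 1)%R.
  apply/andP; split; first by rewrite divr_ge0 ?subr_ge0// ltW.
  by rewrite ler_pdivrMr// mul1r lerDl mulr_ge0 ?ltW.
move=> /(_ isT).
rewrite f1 mule0 add0e.
have -> : ((1 - t) / (1 - t + t * b) * 1 +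
   (1 - (1 - t) / (1 - t + t * b)) * (x / b) =
   (1 - t + t * x) / (1 - t + t * b))%R.
  by field; rewrite !gt_eqF.
have -> : (1 - (1 - t) / (1 - t + t * b) = (t * b) / (1 - t + t * b))%R.
  by field; rewrite !gt_eqF.
move=> h; have {h} : (1 - t + t * b)%:E * f ((1 - t + t * x) / (1 - t + t * b))%R
    <= (1 - t + t * b)%:E * ((t * b / (1 - t + t * b))%:E * f (x / b)%R).
  by apply: lee_wpmul2l => //; rewrite lee_fin ltW.
by rewrite !muleA -!EFinM [(_ * (t * b / _))%R]mulrC divfK ?gt_eqF.
Qed.

(** The constraint in [g_fun], taken as a region of the [(b, z)] plane because the arguments below
    move both coordinates at once. *)
Definition fdiv_feasible (rho b z : R) :=
  (0 <= z <= 1)%R /\ persp f b z + persp f (1 - b) (1 - z) <= rho%:E.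

Lemma fdiv_feasible_refl rho b : (0 <= rho)%R -> (0 <= b <= 1)%R ->
  fdiv_feasible rho b b.
Proof.
move=> rho0 b01; split=> //; case/andP: b01 => b0 b1.
by rewrite !perspxx ?subr_ge0// add0e lee_fin.
Qed.

Lemma fdiv_feasibleC rho b z :
  fdiv_feasible rho b z -> fdiv_feasible rho (1 - b) (1 - z).
Proof.
move=> [z01 bz]; split; first by lra.
by rewrite !subKr addeC.
Qed.

(** The first perspective term is homogeneous, and the complementary pair moves towards [(1, 1)],
    where [persp_convex1] applies; so the divergence shrinks at least by the factor [t]. *)
Lemma fdiv_feasibleZ rho b z t : (0 <= rho)%R -> (0 <= b <= 1)%R ->
  (0 <= t <= 1)%R -> fdiv_feasible rho b z ->
  fdiv_feasible rho (t * b) (t * z).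
Proof.
move=> rho0 b01 t01 [z01 bz]; split; first by nra.
have [->|t0] := eqVneq t 0%R.
  by rewrite !mul0r subr0 !perspxx// add0e lee_fin.
have {}t0 : (0 < t)%R by lra.
rewrite perspZ//.
have h x : (1 - t * x = 1 - t + t * (1 - x))%R by ring.
rewrite !h; apply: (@le_trans _ _ (t%:E * rho%:E)); last first.
  by rewrite -EFinM lee_fin; nra.
apply: le_trans (lee_wpmul2l _ bz); last by rewrite lee_fin ltW.
rewrite muleDr//; last first.
  by move: (persp_neqNy b z) (persp_neqNy (1 - b) (1 - z));
    case: (persp _ _ _) => [?||]; case: (persp _ _ _) => [?||].
by rewrite leeD2l// persp_convex1//; lra.
Qed.

(** Contraction towards [(1, 1)] is contraction towards [(0, 0)] seen through the symmetry
    exchanging [A] with its complement. *)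
Lemma fdiv_feasible_contract1 rho b z t : (0 <= rho)%R -> (0 <= b <= 1)%R ->
  (0 <= t <= 1)%R -> fdiv_feasible rho b z ->
  fdiv_feasible rho (1 - t * (1 - b)) (1 - t * (1 - z)).
Proof.
move=> rho0 b01 t01 /fdiv_feasibleC bz; apply: fdiv_feasibleC.
by apply: fdiv_feasibleZ => //; lra.
Qed.

End perspective.

(** * Integrability, measurability and Jensen's inequality for the generator *)

(** The negative part is dominated by [|g|]. This is what excludes [+oo - +oo], whose value [-oo]
    would satisfy the upper bound on the integral. *)
Lemma integrable_lower_bounded d (T : measurableType d) (R : realType)
    (mu : {measure set T -> \bar R}) (D : set T) (f g : T -> \bar R) :
  measurable D -> measurable_fun D f -> mu.-integrable D g ->
  (forall x, D x -> g x <= f x)%E -> (\int[mu]_(x in D) f x < +oo)%E ->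
  mu.-integrable D f.
Proof.
move=> mD mf /integrableP[mg ig] gf fy; apply/integrableP; split => //.
have fneg : (\int[mu]_(x in D) f^\- x < +oo)%E.
  apply: le_lt_trans ig; apply: ge0_le_integral => //.
  - exact: measurable_funeneg.
  - exact: measurableT_comp.
  - move=> x Dx; rewrite funenegE ge_max abse_ge0 andbT.
    by rewrite -abseN; apply: le_trans (lee_abs _); rewrite leeN2; exact: gf.
rewrite (_ : (fun x => _) = f^\+ \+ f^\-)%E; last by rewrite -fune_abse.
rewrite ge0_integralD//; [|exact: measurable_funepos|exact: measurable_funeneg].
rewrite lte_add_pinfty// ltey; apply/negP => /eqP fpos.
move: fy; rewrite integralE fpos addye ?ltxx// eqe_oppLR/=.
by rewrite lt_eqF.
Qed.

Section generator.
Context (R : realType) (f : R -> \bar R) (hf : fdiv_generator f).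

Lemma fdiv_generator_epigraph_convex (u v : R * R) (t : R) :
  (f u.1 <= u.2%:E)%E -> (f v.1 <= v.2%:E)%E -> 0 <= t <= 1 ->
  (f (t * u.1 + (1 - t) * v.1) <= (t * u.2 + (1 - t) * v.2)%:E)%E.
Proof.
move=> fu fv t01; case: hf => _ cvx _ _ _.
apply: le_trans (cvx _ _ _ t01) _; case/andP: t01 => t0 t1.
by rewrite (EFinD (t * _)) (EFinM t) (EFinM (1 - t)); apply: leeD; apply: lee_wpmul2l => //;
  rewrite lee_fin// subr_ge0.
Qed.

(** Sublevel sets of a convex function are intervals, and their complements are the preimages of a
    generating family. *)
Lemma fdiv_generator_measurable : measurable_fun [set: R] f.
Proof.
move=> mD; apply: (measurability _ (ErealGenOInfty.measurableE R)) => //.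
move=> _ [_ [r ->] <-]; apply: measurableI => //.
rewrite (_ : _ @^-1` _ = ~` [set x | (f x <= r%:E)%E]); last first.
  apply/seteqP; split => x /=; rewrite in_itv/= andbT ltNge.
    by move/negP.
  by move=> ?; exact/negP.
apply: measurableC; apply: is_interval_measurable => x y fx fy z /andP[xz zy].
have [xy|yx] := ltP x y; last by rewrite (_ : z = x)//; lra.
pose t := (y - z) / (y - x).
have t01 : 0 <= t <= 1.
  by rewrite divr_ge0 ?subr_ge0 ?(ltW xy)//= ler_pdivrMr ?subr_gt0//; lra.
have := @fdiv_generator_epigraph_convex (x, r) (y, r) t fx fy t01.
rewrite /= (_ : t * x + (1 - t) * y = z); last first.
  by rewrite /t; field; rewrite subr_eq0 gt_eqF.
by rewrite (_ : t * r + (1 - t) * r = r)//; ring.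
Qed.

Lemma fdiv_generator_affine_minorant :
  exists a b : R, forall t, ((a * t + b)%:E <= f t)%E.
Proof.
case: (hf) => fN _ clf f1 _.
(* [(1, -1)] lies strictly below the epigraph, on the vertical line through its
   point [(1, 0)], so the separating line is not vertical. *)
have [||c Cc cP] := @closed_convex_projection R _ (1, -1) clf.
- by exists (1, 0); rewrite /= f1.
- by move=> u v t; exact: fdiv_generator_epigraph_convex.
(* Testing against [(1, 0)] gives [-1 <= c.2 <= 0], and [c.2 = -1] would force [c = (1, -1)], which
   is outside the epigraph. *)
have c1 : 0 < 1 + c.2.
  have := cP (1, 0); rewrite /= f1 => /(_ (lexx _)) h.
  have h1 : 0 <= (1 - c.1) ^+ 2 by exact: sqr_ge0.
  rewrite ltNge; apply/negP => c2.
  have c2N1 : c.2 = -1 by nra.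
  have c11 : c.1 = 1.
    by apply/eqP; rewrite eq_sym -subr_eq0 -sqrf_eq0; apply/eqP; nra.
  by move: Cc; rewrite /= c11 c2N1 f1 lee_fin; lra.
(* The line through [c] orthogonal to [(1, -1) - c]. *)
exists ((1 - c.1) / (1 + c.2)), (c.2 - (1 - c.1) / (1 + c.2) * c.1) => t.
have := fN t; case ft : (f t) => [v||]//= _; last by rewrite leey.
have := cP (t, v); rewrite /= ft lexx => /(_ isT).
rewrite lee_fin => h; rewrite addrCA -mulrBr mulrAC -lerBrDl ler_pdivrMr//.
by lra.
Qed.

(** Jensen's inequality for the normalised restriction of [mu] to [A], multiplied by the mass of
    [A]; for a null [A] both sides are 0. *)
Lemma persp_le_integral d (T : measurableType d)
    (mu : {finite_measure set T -> \bar R}) (A : set T) (r : T -> R) :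
  measurable A -> mu.-integrable A (EFin \o r) -> mu.-integrable A (f \o r) ->
  (persp f (fine (mu A)) (\int[mu]_(x in A) r x) <= \int[mu]_(x in A) f (r x))%E.
Proof.
move=> mA ir ifr.
have [A0|A0] := eqVneq (mu A) 0%E.
  have int0 (g : T -> \bar R) : mu.-integrable A g ->
      (\int[mu]_(x in A) g x = 0)%E.
    by move=> ig; rewrite (negligible_integral mA)// setDv integral_set0.
  by rewrite /Rintegral !int0// A0 /= /persp ltxx eqxx.
have {}A0 : (0 < mu A)%E by rewrite lt0e A0 measure_ge0.
have mfin : mu A \is a fin_num by exact: fin_num_measure.
have m0 : 0 < fine (mu A) by rewrite -lte_fin fineK.
(* [f (r x)] may be infinite on a null set. On [G] it is real, so that [(r x, f (r x))] is a point
   of the epigraph in the plane. *)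
pose G := A `&` [set x | f (r x) \is a fin_num].
have mG : measurable G by apply: emeasurable_fin_num => //; exact: measurable_int ifr.
have AG0 : mu (A `\` G) = 0%E.
  have [N [mN N0 sN]] := integrable_ae mA ifr.
  apply: (@subset_measure0 _ _ _ mu _ N) => //; first exact: measurableD.
  by move=> x [Ax Gx]; apply: sN => /= /(_ Ax) h; apply: Gx.
have AGE : A `\` (A `\` G) = G by rewrite setDD setIC; apply/setIidPl => x [].
have intG (g : T -> \bar R) : mu.-integrable A g ->
    (\int[mu]_(x in A) g x = \int[mu]_(x in G) g x)%E.
  move=> ig; rewrite (@negligible_integral _ _ _ mu _ (A `\` G))//.
    by rewrite AGE.
  exact: measurableD.
have muG : mu G = mu A.
  have mAG : measurable (A `\` G) by exact: measurableD.
  rewrite -{1}AGE measureD//; last by rewrite ltey_eq mfin.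
  have -> : A `&` (A `\` G) = A `\` G by apply/seteqP; split => [x []//|x [Ax Gx]].
  by rewrite [X in (_ - X)%E]AG0 sube0.
have GA : G `<=` A by move=> x [].
have iG (g : T -> \bar R) : mu.-integrable A g -> mu.-integrable G g.
  exact: integrableS.
pose v x := fine (f (r x)).
have fv : {in G, EFin \o v =1 f \o r}.
  by move=> x; rewrite inE => -[_ /= ?]; rewrite fineK.
have ivG : mu.-integrable G (EFin \o v).
  apply: (@eq_integrable _ _ _ _ _ mG (f \o r)); last exact: iG.
  by move=> x xG; rewrite fv.
have clf : closed [set p : R * R | (f p.1 <= p.2%:E)%E] by case: hf.
have := @jensen_closed_convex _ _ _ mu G [set p | (f p.1 <= p.2%:E)%E] r v mG.
rewrite muG => /(_ A0 (iG _ ir) ivG clf) /= h.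
have {}h := h (fun u w t => @fdiv_generator_epigraph_convex u w t).
rewrite /persp m0 intG// -(eq_integral _ _ fv).
have -> : \int[mu]_(x in A) r x = \int[mu]_(x in G) r x.
  by rewrite /Rintegral intG.
have -> : (\int[mu]_(x in G) (EFin \o v) x)%E = (\int[mu]_(x in G) v x)%:E.
  by rewrite fineK//; exact: integrable_fin_num.
apply: (@le_trans _ _ ((fine (mu A))%:E *
    (\int[mu]_(x in G) v x / fine (mu A))%:E)%E).
  apply: lee_wpmul2l; first by rewrite lee_fin ltW.
  by apply: h => x Gx; rewrite /v fineK//; case: Gx.
by rewrite -EFinM mulrC divfK ?gt_eqF.
Qed.

End generator.

(** * Reduction of the divergence to two-point distributions *)

Lemma two_level_probability d (T : measurableType d) (R : realType)
    (Q : probability T R) (A : set T) (c1 c2 : R) :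
  measurable A -> 0 <= c1 -> 0 <= c2 ->
  c1 * fine (Q A) + c2 * (1 - fine (Q A)) = 1 ->
  exists P : probability T R, forall B, measurable B ->
    P B = (c1%:E * Q (B `&` A) + c2%:E * Q (B `\` A))%E.
Proof.
move=> mA c10 c20 c1c2.
have mCA := measurableC mA.
pose m : {measure set T -> \bar R} := measure_add
  (mscale (NngNum c10) (mrestr Q mA)) (mscale (NngNum c20) (mrestr Q mCA)).
have mE B : m B = (c1%:E * Q (B `&` A) + c2%:E * Q (B `\` A))%E.
  by rewrite [LHS]measure_addE /mscale /= /mrestr setDE.
have mT : m setT = 1%E.
  rewrite mE setTI setTD probability_setC// -(fineK (fin_num_measure Q _ mA)).
  by rewrite -EFinB -!EFinM -EFinD c1c2.
pose P : probability T R :=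
  HB.pack (m : set T -> \bar R) (Measure.class m) (Measure_isProbability.Build _ _ _ m mT).
by exists P => B mB; rewrite -mE.
Qed.

Section fdiv.
Context (R : realType) (f : R -> \bar R) (hf : fdiv_generator f).
Implicit Types P Q : probability R R.
Local Open Scope ereal_scope.
Local Open Scope charge_scope.

Lemma fdiv_two_level P Q (A : set R) (c1 c2 : R) : measurable A ->
  (forall B, measurable B -> P B = c1%:E * Q (B `&` A) + c2%:E * Q (B `\` A)) ->
  fdiv f P Q = f c1 * Q A + f c2 * Q (~` A).
Proof.
move=> mA PE; have mCA := measurableC mA.
have PQ : charge_of_finite_measure P `<< Q.
  apply/null_content_dominatesP => B mB B0.
  have Q0 C : measurable C -> C `<=` B -> Q C = 0.
    by move=> mC CB; exact: (subset_measure0 mC mB CB B0).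
  have := PE B mB; rewrite (Q0 (B `&` A))//; last exact: measurableI.
  by rewrite (Q0 (B `\` A)) ?mule0 ?adde0//; exact: measurableD.
pose w (x : R) := if x \in A then c1 else c2.
have mw : measurable_fun [set: R] w.
  apply: measurable_fun_ifT => //; apply: (measurable_fun_bool true).
  rewrite setTI (_ : _ @^-1` _ = A)//.
  by apply/seteqP; split => x; [exact: set_mem|exact: mem_set].
(* Used twice: with [g := EFin] to identify [w] as the density of [P] almost everywhere, and with
   [g := f] to evaluate the divergence. *)
have split_w (B : set R) (g : R -> \bar R) : measurable B ->
    measurable_fun [set: R] g ->
    \int[Q]_(x in B) g (w x) = g c1 * Q (B `&` A) + g c2 * Q (B `\` A).
  move=> mB mg; rewrite -{1}(setUIDK B A) integral_setU//; last first.
  - by rewrite disj_set2E; apply/eqP; rewrite setDE setIACA setICr setI0.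
  - apply: measurable_funTS; exact: measurableT_comp.
  - exact: measurableD.
  - exact: measurableI.
  congr (_ + _).
    rewrite -integral_cst; last exact: measurableI.
    by apply: eq_integral => x /set_mem[_ xA]; rewrite /w (mem_set xA).
  rewrite -integral_cst; last exact: measurableD.
  by apply: eq_integral => x /set_mem[_ xA]; rewrite /w (memNset xA).
have RNw : ae_eq Q setT ('d (charge_of_finite_measure P) '/d Q) (EFin \o w).
  apply: integral_ae_eq => //.
  - exact: Radon_Nikodym_integrable.
  - exact/measurable_EFinP.
  - move=> E _ mE; rewrite -Radon_Nikodym_integral//.
    by rewrite [LHS]PE// (split_w _ EFin).
have mf := fdiv_generator_measurable _ _ hf.
rewrite /fdiv asboolT//.
rewrite (_ : f c1 * Q A = f c1 * Q (setT `&` A)); last by rewrite setTI.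
rewrite -setTD -split_w//; apply: ae_eq_integral => //.
- apply: (measurableT_comp mf); apply: measurableT_comp.
    exact: fine_measurable.
  exact: measurable_int (Radon_Nikodym_integrable PQ).
- exact: measurableT_comp.
- by apply: filterS RNw => x /[apply] ->.
Qed.

(** Jensen's inequality for the density, on [A] and on its complement separately; the two bounds add
    up to the whole divergence. *)
Lemma fdiv_feasible_measure P Q (A : set R) (rho : R) : measurable A ->
  fdiv f P Q <= rho%:E -> fdiv_feasible _ f rho (fine (Q A)) (fine (P A)).
Proof.
move=> mA PQrho.
have PQ : charge_of_finite_measure P `<< Q.
  by apply: contrapT => nPQ; move: PQrho; rewrite /fdiv asboolF.
move: PQrho; rewrite /fdiv asboolT//.
pose r x := fine ('d (charge_of_finite_measure P) '/d Q x).
rewrite -[X in X <= _]/(\int[Q]_x f (r x)) => frho.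
have iRN := Radon_Nikodym_integrable PQ.
have rE : EFin \o r = 'd (charge_of_finite_measure P) '/d Q.
  by apply/funext => x /=; rewrite fineK//; exact: Radon_Nikodym_fin_num.
have ir : Q.-integrable setT (EFin \o r) by rewrite rE.
have mr : measurable_fun setT r by apply/measurable_EFinP; exact: measurable_int ir.
(* Composed with the integrable density, the affine minorant is an integrable lower bound, so the
   finite upper bound on the divergence yields integrability of [f \o r]. *)
have [a [b abf]] := fdiv_generator_affine_minorant _ _ hf.
have mfr : measurable_fun setT (f \o r).
  by apply: measurableT_comp => //; exact: fdiv_generator_measurable.
have ifr : Q.-integrable setT (f \o r).
  apply: (@integrable_lower_bounded _ _ _ _ _ _
      (fun x => a%:E * (EFin \o r) x + b%:E)) => //.
  - apply: integrableD => //; first exact: integrableZl.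
    exact: finite_measure_integrable_cst.
  - by move=> x _; rewrite /= -EFinM -EFinD; exact: abf.
  - by apply: le_lt_trans frho _; rewrite ltry.
have rP (B : set R) : measurable B -> (\int[Q]_(x in B) r x)%R = fine (P B).
  move=> mB; rewrite /Rintegral; congr fine.
  by rewrite -[RHS](esym (Radon_Nikodym_integral PQ mB)) -rE.
split.
  by rewrite fine_ge0//= -lee_fin fineK ?fin_num_measure// probability_le1.
have pers (B : set R) : measurable B ->
    persp f (fine (Q B)) (fine (P B)) <= \int[Q]_(x in B) f (r x).
  move=> mB; rewrite -rP//; apply: persp_le_integral => //.
    exact: integrableS ir.
  exact: integrableS ifr.
have fineC (Q0 : probability R R) : fine (Q0 (~` A)) = (1 - fine (Q0 A))%R.
  by rewrite probability_setC// fineB// fin_num_measure.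
apply: le_trans frho; rewrite -(setUv A) integral_setU//; last first.
- by rewrite disj_set2E setICr.
- by rewrite setUv.
- exact: measurableC.
rewrite -!fineC; apply: leeD; apply: pers => //; exact: measurableC.
Qed.

(** The density is [z / b] on [A] and [(1 - z) / (1 - b)] off it, with [b] the mass of [A]; its
    divergence is exactly the two-point one. *)
Lemma fdiv_feasible_attained Q (A : set R) (rho z : R) : measurable A ->
  fdiv_feasible _ f rho (fine (Q A)) z ->
  exists2 P : probability R R, P A = z%:E & fdiv f P Q <= rho%:E.
Proof.
move=> mA [z01 hz].
have QA1 : (0 <= fine (Q A) <= 1)%R.
  by rewrite fine_ge0//= -lee_fin fineK ?fin_num_measure// probability_le1.
have QAE : Q A = (fine (Q A))%:E by rewrite fineK ?fin_num_measure.
have QCE : Q (~` A) = (1 - fine (Q A))%:E.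
  by rewrite probability_setC// EFinB -QAE.
set b := fine (Q A) in hz QA1 QAE QCE.
have Pfin := persp_neqNy _ _ hf.
(* This includes [x = 0]: finiteness then forces [y = 0], and [0 / 0 = 0] together with the
   convention that any value times 0 is 0 keeps both identities true. *)
have pE x y : (0 <= x)%R -> persp f x y < +oo ->
    (y / x * x = y)%R /\ persp f x y = f (y / x)%R * x%:E.
  rewrite /persp le_eqVlt => /predU1P[<-|x0].
    by rewrite ltxx; case: eqP => [->|//]; rewrite !mul0r mule0.
  by rewrite x0 divfK ?gt_eqF// muleC.
have [p1 p2] : persp f b z < +oo /\ persp f (1 - b) (1 - z) < +oo.
  move: hz (Pfin b z) (Pfin (1 - b)%R (1 - z)%R).
  by case: (persp _ _ _) => [s||]; case: (persp _ _ _) => [t||]//=;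
    rewrite ?ltry.
have [|zE pzE] := pE b z _ p1; first by case/andP: QA1.
have [|zCE pzCE] := pE (1 - b)%R (1 - z)%R _ p2; first by rewrite subr_ge0; case/andP: QA1.
have [|||P PE] := @two_level_probability _ _ _ Q A (z / b) ((1 - z) / (1 - b)) mA.
- by apply: divr_ge0; lra.
- by apply: divr_ge0; lra.
- by rewrite -/b zE zCE; ring.
exists P.
  by rewrite PE// setIid setDv measure0 mule0 adde0 QAE -EFinM zE.
by rewrite (fdiv_two_level _ _ A _ _ mA PE) QAE QCE -pzE -pzCE.
Qed.

End fdiv.

(** * Strict inequalities for [g_inv] in terms of feasible points *)

Section g_fun.
Context (R : realType) (f : R -> \bar R) (hf : fdiv_generator f).
Context (rho : R) (rho_gt0 : 0 < rho).

Let rho_ge0 : 0 <= rho. Proof. exact: ltW. Qed.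

Lemma g_fun_le b z : fdiv_feasible _ f rho b z -> g_fun f rho b <= z.
Proof. by move=> bz; apply: ge_inf => //; exists 0 => y [/andP[]]. Qed.

Lemma g_fun_lt b a : 0 <= b <= 1 -> g_fun f rho b < a ->
  exists2 z, fdiv_feasible _ f rho b z & z < a.
Proof.
move=> b01 ba; apply: inf_lt ba.
by exists b; exact: fdiv_feasible_refl.
Qed.

(** The complement has reference mass 0, and [persp f 0] is [+oo] off 0, reflecting absolute
    continuity; hence no mass can move there. *)
Lemma fdiv_feasible1 z : fdiv_feasible _ f rho 1 z -> z = 1.
Proof.
case=> z01; rewrite /= subrr => h; apply/eqP; apply: contraT => z1.
move: h; rewrite [persp f 0 _]/persp ltxx subr_eq0 eq_sym (negbTE z1).
by rewrite addey ?leye_eq//; exact: persp_neqNy.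
Qed.

(* The feasible set is star-shaped with respect to both (0, 0) and (1, 1): the
   first point gives strictness of [z < a] from [g <= a], the second one gives
   room to move [b] to the right. *)
Lemma g_inv_gt a b : 0 < a < 1 -> 0 <= b <= 1 ->
  b < g_inv f rho a <-> exists2 z, fdiv_feasible _ f rho b z & z < a.
Proof.
move=> /andP[a0 a1] b01; split=> [ba|[z bz za]].
  have [|B [B01 gB] bB] := sup_gt _ ba.
    exists 0; split; first by rewrite lexx ler01.
    apply: (le_trans (g_fun_le _ _ (fdiv_feasible_refl _ _ hf _ 0 rho_ge0 _))) => //.
      by rewrite lexx ler01.
    exact: ltW.
  have [b0|b0] := eqVneq b 0.
    by exists 0 => //; rewrite b0; apply: fdiv_feasible_refl => //; rewrite lexx ler01.
  have {}b0 : 0 < b by lra.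
  have B0 : 0 < B by lra.
  have t0 : 0 < b / B by exact: divr_gt0.
  have t1 : b / B < 1 by rewrite ltr_pdivrMr// mul1r.
  have gBt : g_fun f rho B < a / (b / B).
    by apply: le_lt_trans gB _; rewrite ltr_pdivlMr// gtr_pMr.
  have [z Bz zt] := g_fun_lt _ _ B01 gBt.
  exists (b / B * z); last by rewrite mulrC -ltr_pdivlMr.
  rewrite -[in fdiv_feasible _ _ _ b](divfK (lt0r_neq0 B0) b).
  by apply: fdiv_feasibleZ => //; rewrite !ltW.
have b1 : b < 1.
  rewrite lt_neqAle; case/andP: b01 => _ ->; rewrite andbT; apply/eqP => b1.
  by move: bz; rewrite b1 => /fdiv_feasible1 z1; move: za a1; rewrite z1; lra.
have [z01 _] := bz.
(* With this factor [z] moves to [z + (a - z) * (1 - z)], still at most [a], while [b] strictly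
   increases because [b < 1]. *)
have t01 : 0 <= 1 - (a - z) <= 1 by lra.
have tbz := fdiv_feasible_contract1 _ _ hf _ _ _ _ rho_ge0 b01 t01 bz.
apply: (@lt_le_trans _ _ (1 - (1 - (a - z)) * (1 - b))); first by nra.
apply: ub_le_sup; first by exists 1 => y [/andP[]].
split; first by nra.
by apply: le_trans (g_fun_le _ _ tbz) _; nra.
Qed.

End g_fun.

(** * Quantiles compared through real thresholds *)

Lemma le_ereal_cut (R : realType) (x y : \bar R) :
  (forall q : R, q%:E < x -> q%:E <= y)%E -> (x <= y)%E.
Proof.
move=> h; rewrite leNgt; apply/negP; move: x y h => [x||] [y||] h //.
- rewrite lte_fin => yx; have := h ((x + y) / 2); rewrite !lte_fin lee_fin; lra.
- by move=> _; have := h (x - 1); rewrite lte_fin leeNy_eq ltrBlDr ltrDl ltr01 => /(_ isT).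
- by move=> _; have := h (y + 1) (ltry _); rewrite lee_fin; lra.
- by move=> _; have := h 0 (ltry _).
Qed.

Lemma le_quantile (R : realType) (P : probability R R) (a q : R) :
  (P `]-oo, q]%classic < a%:E)%E -> (q%:E <= quantile P a)%E.
Proof.
move=> Pq; apply/ereal_infP => _ [p ap <-]; rewrite lee_fin leNgt.
apply/negP => pq; move: ap; apply/negP; rewrite -ltNge.
apply: le_lt_trans Pq; apply: le_measure; rewrite ?inE//.
by apply: subset_itvl; rewrite bnd_simp ltW.
Qed.

Lemma lt_quantile (R : realType) (P : set R -> \bar R) (a q : R) :
  (q%:E < quantile P a)%E -> (P `]-oo, q]%classic < a%:E)%E.
Proof.
rewrite !ltNge; apply: contra => aP.
by apply: ereal_inf_lbound; exists q.
Qed.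

Lemma le_quantile_cdf (R : realType) (F : R -> R) (a q : R) :
  {homo F : x y / x <= y} -> F q < a -> (q%:E <= quantile_cdf F a)%E.
Proof.
move=> ndF Fq; apply/ereal_infP => _ [p /= ap <-]; rewrite lee_fin leNgt.
by apply/negP => /ltW/ndF; rewrite leNgt (lt_le_trans Fq ap).
Qed.

Lemma lt_quantile_cdf (R : realType) (F : R -> R) (a q : R) :
  (q%:E < quantile_cdf F a)%E -> F q < a.
Proof.
apply: contraTT; rewrite -leNgt -leNgt => aF.
by apply: ereal_inf_lbound; exists q.
Qed.

Theorem theorem6 (R : realType)
  (dX dY : measure_display) (X : measurableType dX) (Y : measurableType dY)
  (s : (X * Y)%type -> R) (ms : measurable_fun [set: (X * Y)%type] s)
  (d : nat) (d_gt0 : (0 < d)%N) (S : 'I_d -> probability (X * Y)%type R)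
  (f : R -> \bar R) (hf : fdiv_generator f)
  (rho : R) (rho_gt0 : 0 < rho)
  (F : 'I_d -> R -> R)
  (hF : forall i x, F i x = fine (pushforward (S i) s `]-oo, x]%classic))
  (Fmin : R -> R) (hFmin : forall x, Fmin x = \big[Num.min/1]_(i < d) F i x)
  (Pset : set (probability R R))
  (hPset : Pset = [set P : probability R R | exists S0 : probability R R,
      (exists lam : 'I_d -> R,
         [/\ (forall i, 0 <= lam i), \sum_(i < d) lam i = 1 &
             forall A, measurable A ->
               S0 A = (\sum_(i < d) (lam i)%:E * pushforward (S i) s A)%E])
      /\ (fdiv f P S0 <= rho%:E)%E])
  (alpha : R) (alpha01 : 0 < alpha < 1) :
  ereal_sup [set quantile P alpha | P in Pset] =
  quantile_cdf Fmin (g_inv f rho alpha).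
Proof.
have rho_ge0 := ltW rho_gt0.
pose sm : {mfun (X * Y)%type >-> R} :=
  HB.pack s (isMeasurableFun.Build _ _ _ _ s ms).
pose law i : probability R R := distribution (S i) sm.
have FE i x : (F i x)%:E = law i `]-oo, x]%classic.
  by rewrite hF fineK//; exact: (fin_num_measure (law i)).
have F01 i x : 0 <= F i x <= 1.
  by rewrite -!lee_fin FE measure_ge0 probability_le1.
have ndF i : {homo F i : x y / x <= y}.
  move=> x y xy; rewrite -lee_fin !FE; apply: le_measure; rewrite ?inE//.
  by apply: subset_itvl; rewrite bnd_simp.
have Fmin_le i x : Fmin x <= F i x by rewrite hFmin; exact: bigmin_le.
(* The default 1 of the minimum never undercuts a c.d.f. value, and [d_gt0] supplies an index, so
   the minimum is attained. *)
have Fmin_arg x : exists i, Fmin x = F i x.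
  have [|i _ Fi] := @eq_bigmin _ _ _ 1 (Ordinal d_gt0) xpredT (F^~ x) isT.
    by move=> i _; case/andP: (F01 i x).
  by exists i; rewrite hFmin.
have Fmin01 x : 0 <= Fmin x <= 1 by have [i ->] := Fmin_arg x.
have ndFmin : {homo Fmin : x y / x <= y}.
  move=> x y xy; have [i ->] := Fmin_arg y.
  exact: le_trans (Fmin_le i x) (ndF _ _ _ xy).
apply/eqP; rewrite eq_le; apply/andP; split; apply: le_ereal_cut => q.
- move=> /ereal_sup_gt[_ [P PP <-] /lt_quantile Pq].
  apply: le_quantile_cdf => //; apply/g_inv_gt => //.
  move: PP; rewrite hPset => -[S0 [[lam [lam0 lam1 S0E]] PS0]].
  have S0q := fdiv_feasible_measure _ _ hf _ _ _ _ (measurable_itv `]-oo, q]) PS0.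
  set b := fine (S0 _) in S0q; set z := fine (P _) in S0q.
  have za : z < alpha by rewrite -lte_fin fineK ?fin_num_measure.
  have b01 : 0 <= b <= 1.
    by rewrite fine_ge0//= -lee_fin fineK ?fin_num_measure// probability_le1.
  have Fb : Fmin q <= b.
    have -> : b = \sum_(i < d) lam i * F i q.
      rewrite /b S0E//; under eq_bigr => i _ do rewrite -[pushforward _ _ _]FE -EFinM.
      by rewrite sumEFin.
    rewrite -[leLHS]mul1r -lam1 mulr_suml.
    by apply: ler_sum => i _; rewrite ler_wpM2l.
  (* The mixture value [b] may exceed [Fmin q]. Scaling [(b, z)] by [Fmin q / b] gives a feasible
     point above [Fmin q] without increasing [z]; if [b = 0], the two values coincide already. *)
  have [b0|b0] := eqVneq b 0.
    exists z => //; rewrite (_ : Fmin q = b)//.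
    by apply/eqP; rewrite eq_le Fb b0; case/andP: (Fmin01 q).
  have {}b0 : 0 < b by rewrite lt0r b0; case/andP: b01.
  have t01 : 0 <= Fmin q / b <= 1.
    rewrite divr_ge0 ?(ltW b0) ?andbT//=; last by case/andP: (Fmin01 q).
    by rewrite ler_pdivrMr// mul1r.
  exists (Fmin q / b * z).
    rewrite -[in fdiv_feasible _ _ _ (Fmin q)](divfK (lt0r_neq0 b0) (Fmin q)).
    exact: fdiv_feasibleZ.
  apply: le_lt_trans za; rewrite ler_piMl//; last by case/andP: t01.
  by case: S0q => /andP[].
- move=> /lt_quantile_cdf /g_inv_gt[]// z qz za.
  (* The reference mixture is the single law attaining the minimum at this [q], with a unit weight
     vector. *)
  have [i Fi] := Fmin_arg q.
  have FiE : Fmin q = fine (law i `]-oo, q]%classic) by rewrite Fi hF.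
  rewrite FiE in qz.
  have [P Pz PS] := fdiv_feasible_attained _ _ hf _ _ _ _ (measurable_itv `]-oo, q]) qz.
  have Pset_P : Pset P.
    rewrite hPset; exists (law i); split => //.
    exists (fun j => (j == i)%:R); split.
    + by move=> j; rewrite ler0n.
    + by rewrite (bigD1 i)//= eqxx big1 ?addr0// => j /negbTE ->.
    + move=> A mA; rewrite (bigD1 i)//= eqxx mul1e big1 ?adde0//.
      by move=> j /negbTE ->; rewrite mul0e.
  apply: (@le_trans _ _ (quantile P alpha)).
    by apply: le_quantile; rewrite Pz lte_fin.
  by apply: ereal_sup_ubound; exists P.
Qed.
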